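(* Let $\mathcal C$ be a nowhere dense class of graphs. Then for every $r>0$ there are $\ell,m>0$ such that for every $G\in\mathcal C$, Splitter wins the $(\ell,m,r)$-splitter game on $G$. If $\mathcal C$ is effectively nowhere dense, then $\ell$ and $m$ can be computed from $r$.
   Context: Graphs are finite, simple, undirected. $N_r^G(v)$ denotes the set of vertices at distance at most $r$ from $v$ in $G$; $G[X]$ is the induced subgraph on $X$. A graph $H$ is a depth-$r$ minor of $G$ if there are pairwise vertex-disjoint subgraphs $T_v\subseteq G$ ($v\in V(H)$), each a tree of radius at most $r$, such that for every edge $\{u,v\}\in E(H)$ some edge of $G$ joins $T_u$ and $T_v$. A class $\mathcal C$ is nowhere dense if for every $r$ there is a graph $H_r$ that is not a depth-$r$ minor of any $G\in\mathcal C$; it is effectively nowhere dense if there is a computable function $f$ such that the complete graph $K_{f(r)}$ is not a depth-$r$ minor of any $G\in\mathcal C$, for all $r$. The $(\ell,m,r)$-splitter game on a graph $G$ is played by Connector and Splitter. Let $G_0:=G$. In round $i+1$, Connector chooses a vertex $v_{i+1}\in V(G_i)$; then Splitter chooses a set $W_{i+1}\subseteq N_r^{G_i}(v_{i+1})$ with $|W_{i+1}|\le m$, and $G_{i+1}:=G_i[N_r^{G_i}(v_{i+1})\setminus W_{i+1}]$. Splitter wins if $G_{i+1}$ is empty; otherwise play continues. If Splitter has not won after $\ell$ rounds, Connector wins. A strategy for Splitter maps each partial play together with Connector's next move to a legal answer; it is winning if Splitter wins every play consistent with it; Splitter wins the game on $G$ if he has a winning strategy. *)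

(* Defs.v *)
From mathcomp Require Import all_boot.

Set Implicit Arguments.
Unset Strict Implicit.
Unset Printing Implicit Defensive.

Record sgraph := SGraph {
  vertex :> finType;
  edge : rel vertex;
  edge_sym : symmetric edge;
  edge_irrefl : irreflexive edge
}.

Record subgraph (G : sgraph) := Subgraph {
  svert : {set G};
  sedge : rel G;
  sedge_sym : symmetric sedge;
  sedgeP : forall x y,
    sedge x y -> [&& edge x y, x \in svert & y \in svert]
}.

Section Subgraphs.
Variable G : sgraph.
Implicit Types (H T : subgraph G) (X : {set G}).

Lemma whole_subproof (x y : G) :
  edge x y -> [&& edge x y, x \in [set: G] & y \in [set: G]].
Proof. by rewrite !inE => ->. Qed.

Definition whole : subgraph G := Subgraph (@edge_sym G) whole_subproof.

Lemma induced_sym H X :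
  symmetric [rel x y | [&& sedge H x y, x \in X & y \in X]].
Proof. by move=> x y /=; rewrite sedge_sym [(x \in X) && _]andbC. Qed.

Lemma induced_subproof H X (x y : G) :
  [rel x y | [&& sedge H x y, x \in X & y \in X]] x y ->
  [&& edge x y, x \in svert H :&: X & y \in svert H :&: X].
Proof.
by case/and3P=> /sedgeP/and3P[-> xH yH] xX yX; rewrite !inE xH yH xX yX.
Qed.

(** [induced H X] is H[X]. *)
Definition induced H X : subgraph G :=
  Subgraph (induced_sym H X) (@induced_subproof H X).

(** [nbhd H r v] is N_r^H(v): a vertex is at distance at most r from v in H
    iff some walk of H with at most r edges joins them.  It is empty when v
    is not a vertex of H. *)
Definition nbhd H (r : nat) (v : G) : {set G} :=
  [set u in svert H |
    [exists n : 'I_r.+1, exists p : n.-tuple G,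
       path (sedge H) v p && (last v p == u)]].

Definition connected H : Prop :=
  {in svert H &, forall x y, connect (sedge H) x y}.

Definition acyclic H : Prop :=
  forall c : seq G, 2 < size c -> ~ ucycle (sedge H) c.

Definition is_tree H : Prop :=
  [/\ svert H != set0, connected H & acyclic H].

Definition radius_le H (r : nat) : Prop :=
  exists2 c, c \in svert H & svert H \subset nbhd H r c.

End Subgraphs.

Definition shallow_minor (r : nat) (H G : sgraph) : Prop :=
  exists T : H -> subgraph G,
    [/\ forall v, is_tree (T v) /\ radius_le (T v) r,
        forall u v, u != v -> [disjoint svert (T u) & svert (T v)]
      & forall u v, edge u v ->
          exists x y, [/\ x \in svert (T u), y \in svert (T v) & edge x y]].

Lemma complete_sym n : symmetric [rel i j : 'I_n | i != j].
Proof. by move=> i j /=; rewrite eq_sym. Qed.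

Lemma complete_irrefl n : irreflexive [rel i j : 'I_n | i != j].
Proof. by move=> i /=; rewrite eqxx. Qed.

Definition complete (n : nat) : sgraph :=
  SGraph (@complete_sym n) (@complete_irrefl n).

Definition nowhere_dense (C : sgraph -> Prop) : Prop :=
  forall r, exists H, forall G, C G -> ~ shallow_minor r H G.

(** Total recursive functions: the least class of functions on the natural
    numbers containing the constants 0, the successor and the projections, and
    closed under composition, primitive recursion and minimization of regular
    functions, i.e. of those g for which every x has some y with
    g(y, x) = 0. *)
Inductive recursive : forall n, (n.-tuple nat -> nat) -> Prop :=
| recursive_zero n : recursive (fun _ : n.-tuple nat => 0)
| recursive_succ : recursive (fun x : 1.-tuple nat => (thead x).+1)
| recursive_proj n (i : 'I_n) : recursive (fun x : n.-tuple nat => tnth x i)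
| recursive_comp k n (g : k.-tuple nat -> nat)
    (h : 'I_k -> n.-tuple nat -> nat) :
    recursive g -> (forall i, recursive (h i)) ->
    recursive (fun x => g [tuple h i x | i < k])
| recursive_prim n (g : n.-tuple nat -> nat) (h : n.+2.-tuple nat -> nat)
    (f : n.+1.-tuple nat -> nat) :
    recursive g -> recursive h ->
    (forall x : n.-tuple nat, f [tuple of 0 :: x] = g x) ->
    (forall y (x : n.-tuple nat), f [tuple of y.+1 :: x] =
       h [tuple of y :: f [tuple of y :: x] :: x]) ->
    recursive f
| recursive_min n (g : n.+1.-tuple nat -> nat) (f : n.-tuple nat -> nat) :
    recursive g ->
    (forall x : n.-tuple nat, g [tuple of f x :: x] = 0) ->
    (forall (x : n.-tuple nat) y, y < f x -> g [tuple of y :: x] <> 0) ->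
    recursive f.

Definition computable (f : nat -> nat) : Prop :=
  recursive (fun x : 1.-tuple nat => f (thead x)).

Definition effectively_nowhere_dense (C : sgraph -> Prop) : Prop :=
  exists2 f : nat -> nat, computable f &
    forall r G, C G -> ~ shallow_minor r (complete (f r)) G.

Section SplitterGame.
Variables (l m r : nat) (G : sgraph).

(** The rounds (v_1, W_1), ..., (v_i, W_i) played so far. *)
Definition history := seq (G * {set G}).

Definition next_arena (H : subgraph G) (vW : G * {set G}) : subgraph G :=
  induced H (nbhd H r vW.1 :\: vW.2).

(** The graph G_i reached after the i rounds of [h]. *)
Definition arena (h : history) : subgraph G := foldl next_arena (whole G) h.

Definition legal_answer (h : history) (v : G) (W : {set G}) : Prop :=
  W \subset nbhd (arena h) r v /\ #|W| <= m.

(** Connector can only move while the current graph is nonempty, so a partial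
    play stops as soon as Splitter has won. *)
Inductive partial_play : history -> Prop :=
| partial_play_nil : partial_play [::]
| partial_play_rcons h v W :
    partial_play h -> size h < l -> v \in svert (arena h) ->
    legal_answer h v W -> partial_play (rcons h (v, W)).

Definition splitter_won (h : history) : Prop := svert (arena h) = set0.

Definition play (h : history) : Prop :=
  partial_play h /\ (splitter_won h \/ size h = l).

(** The values of a strategy outside of partial plays in which Connector can
    still move are irrelevant. *)
Definition is_strategy (s : history -> G -> {set G}) : Prop :=
  forall h v, partial_play h -> size h < l -> v \in svert (arena h) ->
    legal_answer h v (s h v).

Inductive consistent (s : history -> G -> {set G}) : history -> Prop :=
| consistent_nil : consistent s [::]
| consistent_rcons h v :
    consistent s h -> consistent s (rcons h (v, s h v)).

Definition winning_strategy (s : history -> G -> {set G}) : Prop :=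
  is_strategy s /\ forall h, play h -> consistent s h -> splitter_won h.

Definition splitter_wins : Prop :=
  exists s : history -> G -> {set G}, winning_strategy s.

End SplitterGame.

(* Main.v *)
Require Import Defs.
From mathcomp Require Import all_boot zify.

(** Splitter answers Connector's move v_j by removing, for every i < j, a walk
    P_ij of length at most r from v_i to v_j taken in the graph G_i in which
    v_i was chosen.  If Connector survives l rounds, then P_ij and P_kl are
    disjoint whenever i < j < k < l.  By Ramsey's theorem for 4-sets we may
    assume that whether P_ij(a) = P_kl(b) depends only on a, b and the order
    type of (i, j, k, l).  Let b be least such that P_ij(b) depends only on j.
    It does not depend on i alone either, for otherwise it would be constant,
    contradicting disjointness.  So the P_ij(b) are distinct connectors, joined
    to v_i by the initial segments of the P_ij, and segments starting at
    distinct v_i meet only in connectors by minimality of b.  This half graph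
    of short paths contains every small clique as a depth-r minor, and the
    required l is bounded by a recursive function of r and the size of the
    clique. *)

Set Implicit Arguments.
Unset Strict Implicit.
Unset Printing Implicit Defensive.

(** * Recursive functions *)

Definition recursive2 (f : nat -> nat -> nat) : Prop :=
  recursive (fun x : 2.-tuple nat => f (tnth x ord0) (tnth x ord_max)).

(** The one-entry tuple is there because [recursive_comp] yields this very term; extensionality
    becomes available only with [recursive_ext]. *)
Lemma recursive_proj_succ n (i : 'I_n) :
  recursive (fun x : n.-tuple nat => (tnth [tuple tnth x i | _ < 1] ord0).+1).
Proof.
exact: (recursive_comp (h := fun=> fun x : n.-tuple nat => tnth x i)
          recursive_succ (fun=> recursive_proj i)).
Qed.

(* Primitive recursion constrains the defined function only pointwise; here it
   recurses on the first argument without using the recursive value. *)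
Lemma recursive_ext n (f g : n.+1.-tuple nat -> nat) :
  recursive f -> f =1 g -> recursive g.
Proof.
move=> rec_f fg.
pose h0 (i : 'I_n.+1) : n.-tuple nat -> nat :=
  if unlift ord0 i is Some j then fun x => tnth x j else fun=> 0.
pose hS (i : 'I_n.+1) : n.+2.-tuple nat -> nat :=
  if unlift ord0 i is Some j then fun x => tnth x (lift ord0 (lift ord0 j))
  else fun x => (tnth [tuple tnth x ord0 | _ < 1] ord0).+1.
have rec_h0 i : recursive (h0 i).
  by rewrite /h0; case: unlift => [j|]; [apply: recursive_proj | apply: recursive_zero].
have rec_hS i : recursive (hS i).
  rewrite /hS; case: unlift => [j|]; first exact: recursive_proj.
  exact: recursive_proj_succ.
apply: (recursive_prim (recursive_comp rec_f rec_h0) (recursive_comp rec_f rec_hS)).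
  move=> x; rewrite -fg; congr (f _); apply: eq_from_tnth => i; rewrite tnth_mktuple /h0.
  by case: unliftP => [j|] ->; rewrite ?tnth0 ?tnthS.
move=> y x; rewrite -fg; congr (f _); apply: eq_from_tnth => i; rewrite tnth_mktuple /hS.
by case: unliftP => [j|] ->; rewrite ?tnth_mktuple ?tnth0 ?tnthS.
Qed.

Lemma recursive2_comp n (f : nat -> nat -> nat) (g h : n.+1.-tuple nat -> nat) :
  recursive2 f -> recursive g -> recursive h -> recursive (fun x => f (g x) (h x)).
Proof.
move=> rec_f rec_g rec_h.
pose gh (i : 'I_2) := if i == ord0 then g else h.
have rec_gh i : recursive (gh i) by rewrite /gh; case: ifP.
by apply: recursive_ext (recursive_comp rec_f rec_gh) _ => x; rewrite !tnth_mktuple.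
Qed.

Lemma computable_comp n (f : nat -> nat) (g : n.+1.-tuple nat -> nat) :
  computable f -> recursive g -> recursive (fun x => f (g x)).
Proof.
move=> rec_f rec_g.
apply: recursive_ext (recursive_comp (h := fun=> g) rec_f (fun=> rec_g)) _.
by move=> x; rewrite /thead tnth_mktuple.
Qed.

Lemma computable_succ : computable S.
Proof. exact: recursive_succ. Qed.

Lemma recursive_const n k : recursive (fun _ : n.+1.-tuple nat => k).
Proof.
elim: k => [|k IHk]; first exact: recursive_zero.
exact: computable_comp computable_succ IHk.
Qed.

Lemma computable_const k : computable (fun=> k).
Proof. exact: recursive_const. Qed.

(** The common form of the recursions below: addition, multiplication, powers of 2 and
    [ramsey_bound]. *)
Lemma recursive2_iter (step : nat -> nat -> nat) (base : nat -> nat) :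
  recursive2 step -> computable base ->
  recursive2 (fun k c => iter k (step^~ c) (base c)).
Proof.
move=> rec_step rec_base.
have rec_S : recursive (fun x : 3.-tuple nat =>
    step (tnth x (lift ord0 ord0)) (tnth x ord_max)).
  by apply: recursive2_comp rec_step _ _; apply: recursive_proj.
apply: recursive_prim rec_base rec_S _ _ => [x|y x].
  by rewrite tnth0 (_ : ord_max = lift ord0 ord0) ?tnthS //; apply: val_inj.
rewrite !tnth0 /= (_ : ord_max = lift ord0 (lift ord0 ord0)); last exact: val_inj.
rewrite !tnthS /= (_ : ord_max = lift ord0 ord0); last exact: val_inj.
by rewrite !tnthS !tnth0.
Qed.

Lemma recursive2_fst (f : nat -> nat) : computable f -> recursive2 (fun x _ => f x).
Proof. by move=> rec_f; apply: computable_comp rec_f _; apply: recursive_proj. Qed.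

Lemma computable_id : computable id.
Proof. exact: recursive_proj. Qed.

Lemma recursive2_add : recursive2 addn.
Proof.
apply: recursive_ext (recursive2_iter (recursive2_fst computable_succ) computable_id) _.
by move=> x /=; rewrite iter_succn addnC.
Qed.

Lemma recursive2_mul : recursive2 muln.
Proof.
apply: recursive_ext (recursive2_iter recursive2_add (computable_const 0)) _ => x /=.
elim: (tnth x ord0) => //= k ->; by rewrite mulSn addnC.
Qed.

Lemma computable_exp2 : computable (expn 2).
Proof.
have rec_step : recursive2 (fun z _ => 2 * z).
  apply: recursive2_comp recursive2_mul _ _; [exact: recursive_const | exact: recursive_proj].
have rec_iter : recursive2 (fun k _ => iter k (fun z => 2 * z) 1).
  exact: (recursive2_iter rec_step (computable_const 1)).
have rec_x := recursive_proj (ord0 : 'I_1).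
apply: recursive_ext (recursive2_comp rec_iter rec_x rec_x) _ => x.
by rewrite /thead; elim: (tnth x ord0) => //= k ->; rewrite expnS.
Qed.

(** * Ramsey's theorem *)

(** For colourings of [k]-sets with [c] colours and a homogeneous set of size [n]. Each iteration
    pays for one element and for a set homogeneous for the [k]-sets beginning with it; among [c * n]
    such elements, [n] share a colour. *)
Fixpoint ramsey_bound (k c n : nat) : nat :=
  if k is k'.+1 then iter (c * n) (fun z => (ramsey_bound k' c z).+1) 0 else n.

Lemma pigeonhole (I : finType) (T : Type) (f : T -> I) (s : seq T) n :
  #|I| * n <= size s -> 0 < #|I| -> exists i, n <= count (fun x => f x == i) s.
Proof.
move=> le_s I_gt0; apply/existsP; rewrite -[X in is_true X]negbK negb_exists.
apply/negP => /forallP few.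
have {few} lt_n i : count (fun x => f x == i) s < n by rewrite ltnNge few.
have size_s : size s = \sum_(i : I) count (fun x => f x == i) s.
  elim: s {lt_n le_s} => [|x s IHs] /=; first by rewrite big1.
  rewrite big_split /= -IHs (bigD1 (f x)) //= eqxx big1 // => i.
  by rewrite eq_sym => /negbTE ->.
have [i0 _] : exists i0 : I, true by case/card_gt0P: I_gt0 => i; exists i.
move: le_s; rewrite leqNgt => /negP; apply.
rewrite size_s -sum_nat_const (bigD1 i0) //= [X in _ < X](bigD1 i0) //=.
by rewrite -addSn leq_add ?leq_sum // => i _; apply: ltnW.
Qed.

Section Ramsey.
Variables (T : eqType) (I : finType) (chi : seq T -> I).

(* The second components record the colours of the sets having the first
   component as their first element. *)
Fixpoint prehomogeneous (k : nat) (ps : seq (T * I)) : Prop :=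
  if ps is p :: ps' then
    (forall u, subseq u (map fst ps') -> size u = k -> chi (p.1 :: u) = p.2)
    /\ prehomogeneous k ps'
  else True.

(** The first element of [u] carries the recorded colour [i], and the others come later in [ps]. *)
Lemma prehomogeneous_filter k i (ps : seq (T * I)) (u : seq T) :
  prehomogeneous k ps -> subseq u [seq p.1 | p <- ps & p.2 == i] ->
  size u = k.+1 -> chi u = i.
Proof.
elim: ps u => [|[a j] ps IHps] u /=; first by move=> _ /eqP ->.
case=> homa hom; case: eqP => /= [ji|_]; last exact: IHps.
case: u => [|b u] //=; case: eqP => [->|_]; last exact: IHps.
move=> sub_u [size_u]; rewrite homa //.
by apply: subseq_trans sub_u _; apply: map_subseq; apply: filter_subseq.
Qed.
End Ramsey.

Theorem ramsey k n (T : eqType) (I : finType) (chi : seq T -> I) (s : seq T) :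
  ramsey_bound k #|I| n <= size s ->
  exists s', [/\ subseq s' s, n <= size s' &
    exists i, forall u, subseq u s' -> size u = k -> chi u = i].
Proof.
elim: k n chi s => [|k IHk] n chi s /= le_s.
  by exists s; split=> //; exists (chi [::]) => u _ /size0nil ->.
(* Greedy choice: the head [a] induces the colouring [chi (a :: u)] of [k]-sets [u], and the
   construction continues inside a subsequence homogeneous for it. *)
have pre M (s0 : seq T) : iter M (fun z => (ramsey_bound k #|I| z).+1) 0 <= size s0 ->
    exists ps : seq (T * I),
      [/\ size ps = M, subseq (map fst ps) s0 & prehomogeneous chi k ps].
  elim: M s0 => [|M IHM] s0 /=; first by exists [::]; rewrite sub0seq.
  case: s0 => [|a s0] //=; rewrite ltnS => le_s0.
  have [s1 [sub1 size1 [i hom1]]] := IHk _ (fun u => chi (a :: u)) _ le_s0.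
  have [ps [size_ps sub_ps hom_ps]] := IHM _ size1.
  exists ((a, i) :: ps); split=> /=; first by rewrite size_ps.
    by rewrite eqxx (subseq_trans sub_ps).
  by split=> // u sub_u; apply: hom1; apply: subseq_trans sub_ps.
have [ps [size_ps sub_ps hom_ps]] := pre _ _ le_s.
have I_gt0 : 0 < #|I| by apply/card_gt0P; exists (chi [::]).
have [|i le_n] := @pigeonhole _ _ (snd : T * I -> I) ps n _ I_gt0; first by rewrite size_ps.
exists [seq p.1 | p <- ps & p.2 == i]; split.
- by apply: subseq_trans sub_ps; apply: map_subseq; apply: filter_subseq.
- by rewrite size_map size_filter.
by exists i => u; apply: prehomogeneous_filter.
Qed.

(** Recursiveness for each fixed uniformity is enough, as only [k = 4] occurs in the bounds. *)
Lemma recursive2_ramsey_bound k : recursive2 (ramsey_bound k).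
Proof.
elim: k => [|k IHk] /=; first exact: recursive_proj.
have rec_step : recursive2 (fun z c => (ramsey_bound k c z).+1).
  apply: computable_comp computable_succ _.
  by apply: recursive2_comp IHk _ _; apply: recursive_proj.
have rec_iter := recursive2_iter rec_step (computable_const 0).
rewrite /recursive2; apply: (recursive2_comp rec_iter); last exact: recursive_proj.
by apply: recursive2_comp recursive2_mul _ _; apply: recursive_proj.
Qed.

(** * Shallow trees *)

Lemma nbhdP (G : sgraph) (H : subgraph G) r (v u : G) :
  reflect (u \in svert H /\
           exists p, [/\ size p <= r, path (sedge H) v p & last v p = u])
          (u \in nbhd H r v).
Proof.
rewrite inE; apply: (iffP andP) => -[uH walk]; split=> //.
  have [n /existsP[p /andP[pathp /eqP lastp]]] := existsP walk.
  by exists p; rewrite size_tuple -ltnS.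
have [p [sizep pathp lastp]] := walk.
apply/existsP; exists (Ordinal (sizep : size p < r.+1)).
by apply/existsP; exists (in_tuple p); rewrite pathp lastp eqxx.
Qed.

(* Joining every vertex other than the root to a neighbour in an earlier layer
   gives a tree: on a cycle, both neighbours of a vertex in the latest layer
   would be its parent. *)
Lemma layered_tree (G : sgraph) r (root : G) (layer : nat -> pred G) :
  (forall x, layer 0 x = (x == root)) ->
  (forall n x, n < r -> layer n.+1 x ->
     exists2 y, layer n y & (y = x \/ edge y x)) ->
  exists T : subgraph G, [/\ is_tree T, radius_le T r &
    forall x, (x \in svert T) = [exists n : 'I_r.+1, layer n x]].
Proof.
move=> layer0 layerS.
pose X := [set x | [exists n : 'I_r.+1, layer n x]].
(* The index of the first layer containing [x]; it is [r.+1] outside [X]. *)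
pose d x := find (layer^~ x) (iota 0 r.+1).
have inX n x : n <= r -> layer n x -> x \in X.
  by move=> le_nr nx; rewrite inE; apply/existsP; exists (Ordinal (le_nr : n < r.+1)).
have d_min n x : n <= r -> layer n x -> d x <= n.
  move=> le_nr nx; rewrite leqNgt; apply/negP => /(before_find 0).
  by rewrite nth_iota ?add0n ?nx.
have dX x : x \in X -> d x <= r /\ layer (d x) x.
  rewrite inE => /existsP[[n lt_nr] /= nx].
  have has_x : has (layer^~ x) (iota 0 r.+1).
    by apply/hasP; exists n => //; rewrite mem_iota.
  have d_lt : d x < r.+1 by rewrite -[r.+1](size_iota 0) -has_find.
  by split=> //; move: (nth_find 0 has_x); rewrite nth_iota.
have rootX : root \in X by apply: (inX 0) => //; rewrite layer0.
pose par x := odflt x [pick y in X | edge y x && (d y < d x)].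
have parP x : x \in X -> x != root ->
    [/\ par x \in X, edge (par x) x & d (par x) < d x].
  move=> xX x_root; rewrite /par; case: pickP => [y /and3P[]//|no_par].
  have [] := dX _ xX; case dx: (d x) => [|k] lt_kr; first by rewrite layer0 (negbTE x_root).
  (* The case [y = x] would put [x] in a layer before its first one. *)
  move=> /(layerS _ _ lt_kr)[y ky] [yx|exy]; have := d_min _ _ (ltnW lt_kr) ky.
    by rewrite yx dx ltnn.
  by move: (no_par y); rewrite /= exy (inX _ _ (ltnW lt_kr) ky) dx ltnS => /= ->.
pose te x y := [&& edge x y, x \in X, y \in X &
  ((x != root) && (par x == y)) || ((y != root) && (par y == x))].
have te_sym : symmetric te.
  by move=> x y; rewrite /te edge_sym orbC; case: (x \in X); rewrite ?andbF.
have teP x y : te x y -> [&& edge x y, x \in X & y \in X] by case/and4P=> -> -> ->.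
pose T := Subgraph te_sym teP.
have te_par x : x \in X -> x != root -> te (par x) x.
  move=> xX x_root; have [pX ep _] := parP _ xX x_root.
  by rewrite /te ep pX xX x_root eqxx orbT.
have te_up x y : te x y -> d y <= d x -> y = par x.
  case/and4P=> _ _ yX /orP[/andP[_ /eqP]//|/andP[y_root /eqP yx]].
  by have [_ _] := parP _ yX y_root; rewrite yx ltnNge => /negbTE->.
have walk x : x \in X -> exists p, [/\ size p <= d x, path te root p & last root p = x].
  have [k] := ubnP (d x); elim: k x => // k IHk x lt_k xX.
  have [->|x_root] := eqVneq x root; first by exists [::].
  have [pX _ lt_d] := parP _ xX x_root.
  have [||p [sizep pathp lastp]] := IHk (par x) => //; first exact: leq_trans lt_d _.
  exists (rcons p x); rewrite size_rcons last_rcons rcons_path pathp lastp.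
  rewrite (leq_trans _ lt_d) //.
  by split=> //; apply: te_par.
exists T; split.
- split; first by apply/set0Pn; exists root.
    have conn x : x \in X -> connect te root x.
      by move=> /walk[p [_ pathp <-]]; apply/connectP; exists p.
    move=> x y xX yX; apply: (connect_trans (y := root)); last exact: conn.
    by rewrite (sym_connect_sym te_sym) conn.
  move=> cyc size_cyc uc.
  have [x0 x0c] : exists x, x \in cyc.
    by case: cyc size_cyc {uc} => // x s _; exists x; rewrite mem_head.
  have [x xc max_x] := arg_maxnP (P := mem cyc) d x0c.
  have [i s rot_s] := rot_to xc.
  have: size (rot i cyc) > 2 by rewrite size_rot.
  have: ucycle te (rot i cyc) by rewrite rot_ucycle.
  have in_c y : y \in x :: s -> d y <= d x by rewrite -rot_s mem_rot; apply: max_x.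
  rewrite rot_s; case: s in_c {rot_s} => // y s in_c /andP[/= /andP[exy]].
  rewrite rcons_path => /andP[_ elx] /and3P[_ ys _] size_s.
  case: s => // z s in in_c elx ys size_s *.
  have yE : y = par x by apply: te_up => //; apply: in_c; rewrite !inE eqxx orbT.
  have lE : last z s = par x.
    apply: te_up; first by rewrite te_sym.
    by apply: in_c; rewrite 2!in_cons mem_last !orbT.
  by move: ys; rewrite yE -lE mem_last.
- exists root => //; apply/subsetP => x xX; apply/nbhdP; split=> //.
  have [p [sizep pathp lastp]] := walk _ xX; exists p; split=> //.
  by apply: leq_trans sizep _; case: (dX _ xX).
by move=> x; rewrite inE.
Qed.

(** * Clique minors from homogeneous paths *)

(* The colours are the sets of equalities between entries [p i j a] and
   [p i' j' a'] with indices among four given ones and [a, a' <= r]. *)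
Definition path_bound (r N : nat) : nat :=
  ramsey_bound 4 (2 ^ ((4 * 4 * r.+1) * (4 * 4 * r.+1))) N.

Lemma sorted_subseq_iota N (u : seq nat) :
  sorted ltn u -> all (gtn N) u -> subseq u (iota 0 N).
Proof.
move=> sorted_u /allP u_lt.
suff -> : u = filter (mem u) (iota 0 N) by apply: filter_subseq.
apply: (irr_sorted_eq ltn_trans ltnn) => //.
  by apply: sorted_filter (iota_ltn_sorted _ _) => ???; apply: ltn_trans.
move=> x; rewrite mem_filter mem_iota /= add0n.
by case xu: (x \in u) => //=; have /= -> := u_lt x xu.
Qed.

(** One implication suffices, since [u] and [w] may be exchanged. Comparisons with fewer than four
    distinct indices are covered by padding the 4-set. *)
Definition homogeneous (T : Type) r N (q : nat -> nat -> nat -> T) : Prop :=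
  forall u w : seq nat, sorted ltn u -> sorted ltn w ->
  all (gtn N) u -> all (gtn N) w -> size u = 4 -> size w = 4 ->
  forall (i j i' j' : 'I_4) a b, a <= r -> b <= r ->
    q (nth 0 u i) (nth 0 u j) a = q (nth 0 u i') (nth 0 u j') b ->
    q (nth 0 w i) (nth 0 w j) a = q (nth 0 w i') (nth 0 w j') b.

Lemma homogeneous_positions (T : eqType) r N l (p : nat -> nat -> nat -> T) :
  path_bound r N <= l ->
  exists x : nat -> nat,
    [/\ forall i j, i < j -> j < N -> x i < x j, forall i, i < N -> x i < l
      & homogeneous r N (fun i j => p (x i) (x j))].
Proof.
pose K : finType := ('I_4 * 'I_4 * 'I_r.+1)%type.
pose chi (u : seq nat) : {ffun K * K -> bool} :=
  [ffun e : K * K => p (nth 0 u e.1.1.1) (nth 0 u e.1.1.2) e.1.2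
          == p (nth 0 u e.2.1.1) (nth 0 u e.2.1.2) e.2.2].
move=> le_l.
have [|s [sub_s size_s [col hom]]] := @ramsey 4 N _ _ chi (iota 0 l).
  by rewrite card_ffun !card_prod card_bool !card_ord size_iota.
have sorted_s : sorted ltn s by apply: (subseq_sorted ltn_trans) sub_s (iota_ltn_sorted _ _).
exists (nth 0 s); split.
- move=> i j lt_ij lt_jN; apply: (sorted_ltn_nth ltn_trans) => //.
    by rewrite inE (leq_trans _ size_s) // (ltn_trans lt_ij).
  by rewrite inE (leq_trans _ size_s).
- move=> i lt_iN; have : nth 0 s i \in s by apply: mem_nth; apply: leq_trans size_s.
  by move=> /(mem_subseq sub_s); rewrite mem_iota.
have chiE u : sorted ltn u -> all (gtn N) u -> size u = 4 -> chi (map (nth 0 s) u) = col.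
  move=> sorted_u u_lt size_u; apply: hom; last by rewrite size_map.
  rewrite -[X in subseq _ X](mkseq_nth 0); apply/map_subseq/sorted_subseq_iota => //.
  by apply: sub_all u_lt => i /= /leq_trans->.
move=> u w sorted_u sorted_w u_lt w_lt size_u size_w i j i' j' a b le_a le_b.
have chiuw : chi (map (nth 0 s) u) = chi (map (nth 0 s) w) by rewrite !chiE.
have := congr1 (fun f : {ffun K * K -> bool} =>
  f ((i, j, Ordinal (le_a : a < r.+1)), (i', j', Ordinal (le_b : b < r.+1)))) chiuw.
by rewrite !ffunE /= !(nth_map 0) ?size_u ?size_w // => eq_uw /eqP; rewrite eq_uw => /eqP.
Qed.

(** The clique vertex [t] gets the low index [2 * t], the odd numbers staying free as gaps; [n * n]
    further indices code pairs, and 5 more leave room for test patterns on 0 to 4 and for a spare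
    top index. *)
Lemma homogeneous_clique_minor (G : sgraph) r n N (q : nat -> nat -> nat -> G) :
  2 * n + n * n + 5 <= N ->
  (forall i j j', i < j < N -> i < j' < N -> q i j 0 = q i j' 0) ->
  (forall i i' j, i < j < N -> i' < j -> q i j r = q i' j r) ->
  (forall i j a, i < j < N -> a < r ->
     q i j a.+1 = q i j a \/ edge (q i j a) (q i j a.+1)) ->
  (forall i j k k' a, [/\ i < j, j < k, k < k' & k' < N] -> a <= r ->
     q i j a != q k k' a) ->
  homogeneous r N q ->
  shallow_minor r (complete n) G.
Proof.
move=> le_N start stop step disj hom.
pose o0 : 'I_4 := Ordinal (isT : 0 < 4). pose o1 : 'I_4 := Ordinal (isT : 1 < 4).
pose o2 : 'I_4 := Ordinal (isT : 2 < 4). pose o3 : 'I_4 := Ordinal (isT : 3 < 4).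
(* The spare index, which pads three given indices to a 4-set. *)
pose M := N.-1.
(* By homogeneity this one instance decides whether entry [a] is independent of the lower index. *)
pose right a := q 0 2 a == q 1 2 a.
have rightE a i i' j : a <= r -> right a -> i < i' -> i' < j -> j < M -> q i j a = q i' j a.
  move=> le_ar /eqP right_a lt_i lt_ij lt_jM.
  by apply: (hom [:: 0; 1; 2; 3] [:: i; i'; j; M] _ _ _ _ _ _ o0 o2 o1 o2) => //=; lia.
have rightI a i i' j : a <= r -> i < i' -> i' < j -> j < M -> q i j a = q i' j a -> right a.
  move=> le_ar lt_i lt_ij lt_jM eq_q; apply/eqP.
  by apply: (hom [:: i; i'; j; M] [:: 0; 1; 2; 3] _ _ _ _ _ _ o0 o2 o1 o2) => //=; lia.
have left_right a i j j' : a <= r -> right a -> i < j -> j < j' -> j' < M ->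
    q i j a = q i j' a -> False.
  move=> le_ar right_a lt_ij lt_j lt_jM eq_q.
  (* The index 2 is skipped so that the pairs (0, 1) and (2, 3) can be linked through (0, 3),
     against [disj]. *)
  have eq1 : q 0 1 a = q 0 3 a.
    by apply: (hom [:: i; j; j'; M] [:: 0; 1; 3; 4] _ _ _ _ _ _ o0 o1 o0 o2) => //=; lia.
  have eq2 : q 0 3 a = q 2 3 a by apply: rightE => //; lia.
  have /eqP[] : q 0 1 a != q 2 3 a by apply: disj => //; split; lia.
  by rewrite eq1.
have right_r : right r by apply/eqP/stop; lia.
have [b right_b b_min] := ex_minnP (ex_intro right r right_r).
have le_br : b <= r by apply: b_min.
(* Entry 0 depends on the lower index alone, so it cannot be a right index. *)
have b_gt0 : 0 < b.
  rewrite lt0n; apply/eqP => b0; rewrite b0 in right_b.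
  by apply: (left_right 0 0 1 2) => //; [lia | apply: start; lia].
(* Moving the low end [i] within its gap preserves the order type, so the
   equality would make [a] a right index. *)
have separate i i' j j' a a' : a < b -> a' <= b -> i.+1 < 2 * n -> i' < 2 * n ->
    2 * n <= j < M -> 2 * n <= j' < M -> i != i' -> i.+1 != i' ->
    q i j a = q i' j' a' -> False.
  move=> lt_ab le_a' lt_i lt_i' bd_j bd_j' neq_i neq_Si eq_q.
  suff eq_q' : q i.+1 j a = q i' j' a'.
    have : right a by apply: (rightI a i i.+1 j); [lia..|rewrite eq_q'].
    by move=> /b_min; lia.
  have le_ar : a <= r by lia.
  have le_ar' : a' <= r by lia.
  have [lt_ii|lt_ii|eq_ii] := ltngtP i i';
    last (by rewrite eq_ii eqxx in neq_i);
    have [lt_jj|lt_jj|eq_jj] := ltngtP j j'.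
  - by apply: (hom [:: i; i'; j; j'] [:: i.+1; i'; j; j'] _ _ _ _ _ _ o0 o2 o1 o3) => //=; lia.
  - by apply: (hom [:: i; i'; j'; j] [:: i.+1; i'; j'; j] _ _ _ _ _ _ o0 o3 o1 o2) => //=; lia.
  - rewrite -eq_jj in eq_q *.
    by apply: (hom [:: i; i'; j; M] [:: i.+1; i'; j; M] _ _ _ _ _ _ o0 o2 o1 o2) => //=; lia.
  - by apply: (hom [:: i'; i; j; j'] [:: i'; i.+1; j; j'] _ _ _ _ _ _ o1 o2 o0 o3) => //=; lia.
  - by apply: (hom [:: i'; i; j'; j] [:: i'; i.+1; j'; j] _ _ _ _ _ _ o1 o3 o0 o2) => //=; lia.
  - rewrite -eq_jj in eq_q *.
    by apply: (hom [:: i'; i; j; M] [:: i'; i.+1; j; M] _ _ _ _ _ _ o1 o2 o0 o2) => //=; lia.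
(* A two-digit code in base [n] of the unordered pair, shifted above the low indices; division by
   [n] recovers the smaller element. *)
pose J (t t' : 'I_n) := 2 * n + (minn t t' * n + maxn t t').
have bdJ t t' : 2 * n <= J t t' < M.
  have lt_t := ltn_ord t; have lt_t' := ltn_ord t'; rewrite /J.
  have : (minn t t').+1 * n <= n * n by rewrite leq_mul2r; lia.
  lia.
have symJ t t' : J t t' = J t' t by rewrite /J minnC maxnC.
have injJ (t t' u u' : 'I_n) : t <= t' -> u <= u' -> J t t' = J u u' -> t = u.
  move=> le_t le_u; rewrite /J.
  rewrite (minn_idPl le_t) (maxn_idPr le_t) (minn_idPl le_u) (maxn_idPr le_u).
  move/addnI => /(congr1 (divn^~ n)).
  have n_gt0 : 0 < n by case: (n) t {le_t le_u} => // -[].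
  by rewrite !divnMDl // !divn_small ?ltn_ord // !addn0 => /val_inj.
(* The connector of a pair, its entry [b], goes to the branch set of the smaller element only. *)
pose layer (t : 'I_n) k : pred G := fun x =>
  [exists t' : 'I_n, ((k < b) || (k == b) && (t <= t')) && (q (2 * t) (J t t') k == x)].
have tree t : exists T : subgraph G, [/\ is_tree T, radius_le T r &
    forall x, (x \in svert T) = [exists k : 'I_r.+1, layer t k x]].
  apply: (@layered_tree _ _ (q (2 * t) (J t t) 0)) => [x|k x lt_kr].
    have start_t t' : q (2 * t) (J t t') 0 = q (2 * t) (J t t) 0.
      by apply: start; have := bdJ t t; have := bdJ t t'; have := ltn_ord t; lia.
    apply/existsP/eqP => [[t' /andP[_ /eqP <-]]|->] //.
    by exists t; rewrite b_gt0 eqxx.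
  case/existsP=> t' /andP[le_k /eqP <-]; exists (q (2 * t) (J t t') k).
    by apply/existsP; exists t'; rewrite eqxx andbT; lia.
  have lt_J : 2 * t < J t t' < N by have := bdJ t t'; have := ltn_ord t; lia.
  by have [->|e_q] := step _ _ _ lt_J lt_kr; [left|right].
have {tree}[T /all_and3[tree_T radius_T inT]] := fin_all_exists tree.
have memT x (t : 'I_n) : x \in svert (T t) -> exists k (t' : 'I_n),
    [/\ k <= b, k < b \/ k = b /\ t <= t' & x = q (2 * t) (J t t') k].
  rewrite inT => /existsP[k /existsP[t' /andP[le_k /eqP <-]]].
  by exists k, t'; split=> //; lia.
have Tmem (t t' : 'I_n) k : k < b \/ k = b /\ t <= t' -> q (2 * t) (J t t') k \in svert (T t).
  move=> le_k; rewrite inT; have lt_kr : k < r.+1 by lia.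
  by apply/existsP; exists (Ordinal lt_kr); apply/existsP; exists t'; rewrite eqxx /=; lia.
have disjT (t u : 'I_n) : t != u -> [disjoint svert (T t) & svert (T u)].
  move=> tu; apply/pred0P => x /=; apply/negP => /andP[].
  have tu' : t <> u :> nat by move/val_inj/eqP; apply/negP.
  move=> /memT[k [t' [le_k k_t ->]]] /memT[k' [u' [le_k' k_u eq_q]]].
  have [lt_t lt_u] := (ltn_ord t, ltn_ord u).
  have [J_t J_u] := (bdJ t t', bdJ u u').
  (* The low indices [2 * t] and [2 * u] are neither equal nor consecutive, so [separate] excludes
     all cases but that of two connectors. *)
  case: k_t => [lt_kb|[kb le_t]]; first by apply: separate eq_q => //; lia.
  case: k_u => [lt_kb|[kb' le_u]]; first by apply: separate (esym eq_q) => //; lia.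
  rewrite {}kb {}kb' in eq_q.
  have {}eq_q : q (2 * t) (J t t') b = q (2 * t) (J u u') b.
    rewrite eq_q; have [?|?|//] := ltngtP t u.
      2: by rewrite (rightE b (2 * u) (2 * t)) //; lia.
    by rewrite -(rightE b (2 * t) (2 * u)) //; lia.
  have [?|?|/injJ eqJ] := ltngtP (J t t') (J u u').
  - by apply: (left_right b (2 * t) (J t t') (J u u')) => //; lia.
  - by apply: (left_right b (2 * t) (J u u') (J t t')) => //; lia.
  by case/eqP: tu; apply: eqJ.
have edgeT (t u : 'I_n) : t < u ->
    exists x y, [/\ x \in svert (T t), y \in svert (T u) & edge x y].
  move=> lt_tu; have [lt_u J_t] := (ltn_ord u, bdJ t u).
  have xT : q (2 * t) (J t u) b \in svert (T t) by apply: Tmem; right; split=> //; apply: ltnW.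
  (* The segment from [2 * u] stops one entry before the connector that it shares with [2 * t]. *)
  have yT : q (2 * u) (J t u) b.-1 \in svert (T u) by rewrite symJ; apply: Tmem; left; lia.
  exists (q (2 * t) (J t u) b), (q (2 * u) (J t u) b.-1); split=> //.
  have right_J : q (2 * t) (J t u) b = q (2 * u) (J t u) b by apply: rightE => //; lia.
  (* If the walk paused here, the two branch sets would share a vertex. *)
  have [||eq_q|] := step (2 * u) (J t u) b.-1; [lia|lia| |].
    rewrite prednK // in eq_q; rewrite right_J eq_q in xT.
    have /pred0P/(_ (q (2 * u) (J t u) b.-1)) := disjT t u (negbT (ltn_eqF lt_tu)).
    by rewrite /= xT yT.
  by rewrite prednK // right_J edge_sym.
exists T; split=> // t u tu; have : t != u :> nat := tu.
rewrite neq_ltn => /orP[/edgeT//|/edgeT[x [y [xT yT exy]]]].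
by exists y, x; rewrite edge_sym.
Qed.

(** * The splitter game *)

Section Strategy.
Variables (G : sgraph) (r : nat).

(* Total: [walk H u v k] is constantly [v] after a walk from [u] to [v] of
   length at most [r] has ended. *)
Definition walk (H : subgraph G) (u v : G) (k : nat) : G :=
  let p := odflt [bseq] [pick p : r.-bseq G | path (sedge H) u p && (last u p == v)] in
  nth v (u :: p) k.

Lemma walkP (H : subgraph G) (u v : G) :
  u \in svert H -> v \in nbhd H r u ->
  [/\ walk H u v r = v,
      forall k, walk H u v k \in svert H
    & forall k, walk H u v k.+1 = walk H u v k \/
                edge (walk H u v k) (walk H u v k.+1)].
Proof.
move=> uH vN; rewrite /walk.
case: pickP => [[p sizep] /= /andP[pathp /eqP lastp]|no_p]; last first.
  have /nbhdP[_ [p [sizep pathp lastp]]] := vN.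
  by have := no_p (Bseq sizep); rewrite /= pathp lastp eqxx.
have vH : v \in svert H by case/nbhdP: vN.
have pH : {subset u :: p <= svert H}.
  move=> x; rewrite inE => /predU1P[->//|].
  elim: (p) (u) pathp => //= y s IHs z.
  by case/andP=> /sedgeP/and3P[_ _ yH] paths /predU1P[->//|]; apply: IHs paths.
split=> //=.
- case: (ltngtP (size p) r) sizep => // [lt_p|eq_p] _.
    by rewrite nth_default.
  by rewrite -eq_p -[size p]/(size (u :: p)).-1 nth_last.
- move=> k; have [lt_k|le_k] := ltnP k (size (u :: p)); last by rewrite nth_default.
  by apply: pH; apply: mem_nth.
move=> k; have [lt_k|le_k] := ltnP k (size p).
  right; have /(pathP v)/(_ k lt_k) := pathp.
  by case/sedgeP/and3P.
left; rewrite (@nth_default _ _ _ k) //; move: le_k; rewrite leq_eqVlt => /predU1P[<-|lt_k].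
  by rewrite -[size p]/(size (u :: p)).-1 nth_last.
by rewrite nth_default.
Qed.

Definition played (h : history G) (v : G) (i : nat) : G := nth v (map fst h) i.

(** Intersecting with the neighbourhood makes the answer legal at no cost, since vertices outside it
    leave the arena anyway. *)
Definition splitter_answer (h : history G) (v : G) : {set G} :=
  nbhd (arena r h) r v :&:
  [set walk (arena r (take ij.1 h)) (played h v ij.1) v ij.2
     | ij : 'I_(size h) * 'I_r.+1].

Lemma arena_rcons (h : history G) (vW : G * {set G}) :
  arena r (rcons h vW) = next_arena r (arena r h) vW.
Proof. by rewrite /arena foldl_rcons. Qed.

Lemma next_arenaE (H : subgraph G) (vW : G * {set G}) (x : G) :
  x \in svert (next_arena r H vW) =
  [&& x \in svert H, x \in nbhd H r vW.1 & x \notin vW.2].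
Proof. by rewrite /= !inE [(x \notin _) && _]andbC. Qed.

Lemma arena_takeS (h : history G) i (v : G) : i < size h ->
  arena r (take i.+1 h) = next_arena r (arena r (take i h)) (nth (v, set0) h i).
Proof. by move=> lt_i; rewrite (take_nth (v, set0)) // arena_rcons. Qed.

Lemma arena_take_sub (h : history G) i j : i <= j -> j <= size h ->
  svert (arena r (take j h)) \subset svert (arena r (take i h)).
Proof.
elim: j => [|j IHj]; first by rewrite leqn0 => /eqP->.
rewrite leq_eqVlt => /predU1P[->//|le_ij] lt_j.
apply: subset_trans (IHj le_ij (ltnW lt_j)).
have [v _] : exists v : G, true by case: (h) lt_j => // -[v W]; exists v.
rewrite (arena_takeS v) //.
by apply/subsetP => x; rewrite next_arenaE => /and3P[].
Qed.

Lemma partial_play_played l m (h : history G) (v : G) i :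
  partial_play l m r h -> i < size h ->
  played h v i \in svert (arena r (take i h)).
Proof.
elim=> // {}h {}v0 W _ IHh _ vh _; rewrite size_rcons ltnS leq_eqVlt /played map_rcons.
move=> /predU1P[->|lt_i].
  by rewrite nth_rcons size_map ltnn eqxx -cats1 take_size_cat.
by rewrite nth_rcons size_map lt_i -cats1 takel_cat ?IHh // ltnW.
Qed.

Lemma consistent_answer s (h : history G) (v : G) i : consistent s h -> i < size h ->
  nth (v, set0) h i = (played h v i, s (take i h) (played h v i)).
Proof.
elim=> // {}h v0 _ IHh; rewrite size_rcons ltnS leq_eqVlt.
rewrite /played map_rcons !nth_rcons size_map.
move=> /predU1P[->|lt_i]; first by rewrite ltnn eqxx -cats1 take_size_cat.
by rewrite lt_i -cats1 takel_cat ?(ltnW lt_i) // IHh.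
Qed.
End Strategy.

Lemma splitter_answer_strategy (G : sgraph) r l :
  is_strategy l (l * r.+1) r (@splitter_answer G r).
Proof.
move=> h v _ lt_l _; split; first exact: subsetIl.
apply: leq_trans (subset_leq_card (subsetIr _ _)) _.
apply: leq_trans (leq_imset_card _ _) _.
by rewrite card_prod !card_ord leq_mul2r ltnW ?orbT.
Qed.

(** The size [2 * n + n * n + 5] is what [homogeneous_clique_minor] asks for; the successor makes
    positivity immediate. *)
Definition rounds_bound (r n : nat) : nat := (path_bound r (2 * n + n * n + 5)).+1.

(** A play that survives all rounds, thinned out by [homogeneous_positions], supplies walks to which
    [homogeneous_clique_minor] applies. *)
Theorem splitter_wins_of_no_clique_minor (G : sgraph) r n :
  ~ shallow_minor r (complete n) G ->
  splitter_wins (rounds_bound r n) (rounds_bound r n * r.+1) r G.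
Proof.
move=> no_minor; exists (@splitter_answer G r); split; first exact: splitter_answer_strategy.
move=> h [play_h [//|size_h]] cons_h; case: no_minor.
have [v0 _] : exists v : G, true.
  by case: h size_h {play_h cons_h} => // -[v W] h _; exists v.
pose v i := played h v0 i.
pose A i := arena r (take i h).
pose p i j := walk r (A i) (v i) (v j).
have vA i : i < size h -> v i \in svert (A i) by apply: partial_play_played play_h.
have answerE i : i < size h -> nth (v0, set0) h i = (v i, splitter_answer r (take i h) (v i)).
  by apply: consistent_answer.
have pP i j : i < j < size h ->
    [/\ p i j r = v j, forall k, p i j k \in svert (A i)
      & forall k, p i j k.+1 = p i j k \/ edge (p i j k) (p i j k.+1)].
  case/andP=> lt_ij lt_j; have lt_i := ltn_trans lt_ij lt_j.
  apply: walkP; first exact: vA.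
  (* [v j] is still present after the round of [v i], hence within distance [r] of [v i] in
     [A i]. *)
  have := subsetP (arena_take_sub r lt_ij (ltnW lt_j)) _ (vA j lt_j).
  by rewrite (arena_takeS _ v0) // next_arenaE answerE // => /and3P[].
(* After round [j] no vertex of a walk from an earlier [v i] to [v j] is left. *)
have removed i j k : i < j -> j < size h -> k <= r -> p i j k \notin svert (A j.+1).
  move=> lt_ij lt_j le_k; apply/negP.
  rewrite /A (arena_takeS _ v0) // next_arenaE answerE // => /and3P[_ /= pN].
  case/negP; rewrite inE pN; apply/imsetP.
  have lt_i : i < size (take j h) by rewrite size_takel // ltnW.
  have playedE : played (take j h) (v j) i = v i.
    rewrite /played map_take nth_take //; apply: set_nth_default.
    by rewrite size_map (ltn_trans lt_ij).
  have takeE : take i (take j h) = take i h by rewrite take_takel // ltnW.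
  by exists (Ordinal lt_i, Ordinal (le_k : k < r.+1)); rewrite //= playedE takeE.
have [|x [x_inc x_lt hom]] := @homogeneous_positions _ r (2 * n + n * n + 5) (size h) p.
  by rewrite size_h.
have x_pair i j : i < j < 2 * n + n * n + 5 -> x i < x j < size h.

  by case/andP=> lt_ij lt_j; rewrite x_inc ?x_lt.
apply: (homogeneous_clique_minor (q := fun i j => p (x i) (x j)) (leqnn _)) => //.
- move=> i i' j ij lt_i'; have [stop _ _] := pP _ _ (x_pair _ _ ij).
  have ij' : i' < j < 2 * n + n * n + 5 by case/andP: ij => _ ->; rewrite lt_i'.
  have [stop' _ _] := pP _ _ (x_pair _ _ ij').
  exact: etrans stop (esym stop').
- by move=> i j a /x_pair/pP[_ _ stepp] _; apply: stepp.
move=> i j k k' a [lt_ij lt_jk lt_k lt_k'] le_a.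
have [lt_xij lt_xj] : x i < x j /\ x j < size h by split; [apply: x_inc|apply: x_lt]; lia.
(* The earlier walk is gone after round [x j], while the later one lies in [A (x k)], which is
   contained in [A (x j).+1]. *)
apply/eqP => eq_p; have /negP[] := removed _ _ _ lt_xij lt_xj le_a.
have /x_pair/pP[_ pA _] : k < k' < 2 * n + n * n + 5 by rewrite lt_k.
rewrite eq_p; apply: subsetP (pA a); apply: arena_take_sub.
  by apply: x_inc => //; lia.
by apply/ltnW/x_lt; lia.
Qed.

(** Lets an arbitrary excluded graph be replaced by a clique; irreflexivity ensures that edges of
    [H] become edges of the clique. *)
Lemma shallow_minor_complete r (H G : sgraph) :
  shallow_minor r (complete #|H|) G -> shallow_minor r H G.
Proof.
case=> T [treeT disjT edgeT]; exists (fun v => T (enum_rank v)); split=> [v|u v uv|u v uv].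
- exact: treeT.
- by apply: disjT; rewrite (inj_eq enum_rank_inj).
apply: edgeT; rewrite /edge /= (inj_eq enum_rank_inj).
by apply: contraTneq uv => ->; rewrite edge_irrefl.
Qed.

Lemma computable_rounds_bound (f : nat -> nat) :
  computable f -> computable (fun r => rounds_bound r (f r)).
Proof.
move=> rec_f.
have rec_add n (g h : n.+1.-tuple nat -> nat) :
    recursive g -> recursive h -> recursive (fun x => g x + h x).
  exact: recursive2_comp recursive2_add.
have rec_mul n (g h : n.+1.-tuple nat -> nat) :
    recursive g -> recursive h -> recursive (fun x => g x * h x).
  exact: recursive2_comp recursive2_mul.
have rec_r : computable (fun r => 4 * 4 * r.+1).
  by apply: rec_mul; [apply: recursive_const | apply: computable_succ].
apply: computable_comp computable_succ _.
apply: (recursive2_comp (recursive2_ramsey_bound 4)).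
  by apply: computable_comp computable_exp2 _; apply: rec_mul.
apply: (rec_add); last exact: recursive_const.
apply: rec_add; first by apply: rec_mul rec_f; apply: recursive_const.
exact: rec_mul.
Qed.

Theorem theorem4p2 (C : sgraph -> Prop) (hC : nowhere_dense C) :
  (forall r : nat, 0 < r ->
     exists l m : nat,
       [/\ 0 < l, 0 < m & forall G : sgraph, C G -> splitter_wins l m r G]) /\
  (effectively_nowhere_dense C ->
     exists l m : nat -> nat,
       [/\ computable l, computable m &
         forall r : nat, 0 < r ->
           [/\ 0 < l r, 0 < m r &
             forall G : sgraph, C G -> splitter_wins (l r) (m r) r G]]).
Proof.
split=> [r _|[f rec_f no_minor]].
  have [H no_minor] := hC r.
  exists (rounds_bound r #|H|), (rounds_bound r #|H| * r.+1); split=> // G CG.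
  apply: splitter_wins_of_no_clique_minor => /shallow_minor_complete; exact: no_minor.
have rec_l := computable_rounds_bound rec_f.
exists (fun r => rounds_bound r (f r)), (fun r => rounds_bound r (f r) * r.+1).
split=> // [|r _].
  exact: (recursive2_comp recursive2_mul rec_l computable_succ).
split=> // G CG; apply: splitter_wins_of_no_clique_minor; exact: no_minor.
Qed.
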